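(* Let $X$ be a rearrangement invariant space on $\Omega$, where $\Omega=(0,1)$ or $\Omega=(0,\infty)$, with the Fatou property. Then for every $f\in X$, $$\operatorname{dist}_X(f^*,X_a)=\operatorname{dist}_X(f,X_a).$$
   Context: A rearrangement invariant space on $\Omega$ (Lebesgue measure) is a Banach space $X\subset L_0(\Omega)$ such that $|f|\le|g|$ a.e., $g\in X$ imply $f\in X$, $\|f\|_X\le\|g\|_X$, containing an a.e. positive function, and such that whenever $f\in X$ and $g$ has the same distribution function as $f$ ($d_f(\lambda)=m\{|f|>\lambda\}$), then $g\in X$ and $\|g\|_X=\|f\|_X$. Fatou property: if $0\le f_n\uparrow f$ a.e., $f_n\in X$, $\sup_n\|f_n\|_X<\infty$, then $f\in X$ and $\|f_n\|_X\uparrow\|f\|_X$. $f^*(t)=\inf\{\lambda>0:d_f(\lambda)\le t\}$ is the non-increasing rearrangement (regarded as a function on $\Omega$). $X_a$ is the ideal of order continuous elements: $f\in X_a$ iff for every sequence $0\le f_n\le|f|$ with $f_n\downarrow0$ a.e. one has $\|f_n\|_X\to0$. $\operatorname{dist}_X(h,X_a)=\inf\{\|h-g\|_X:g\in X_a\}$. *)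

(* Defs.v *)
From HB Require Import structures.
From mathcomp Require Import all_boot all_order all_algebra.
From mathcomp Require Import all_classical all_reals all_analysis.
Set Implicit Arguments. Unset Strict Implicit. Unset Printing Implicit Defensive.
Import Order.TTheory GRing.Theory Num.Theory.
Import numFieldNormedType.Exports.
Local Open Scope classical_set_scope.
Local Open Scope ring_scope.

Section RI.
Variable R : realType.

Definition leb := (@lebesgue_measure R).

Definition ae_on (Om : set R) (P : R -> Prop) : Prop :=
  {ae leb, forall x, Om x -> P x}.

Definition distrib (Om : set R) (f : R -> R) (l : R) : \bar R :=
  leb (Om `&` [set x | l < `|f x|]).

Definition decr_rearr (Om : set R) (f : R -> R) (t : R) : R :=
  fine (ereal_inf [set (l%:E)%E | l in [set l : R | 0 < l /\ (distrib Om f l <= t%:E)%E]]).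

(* X is a (real) Banach space of (classes of) measurable functions on Om,
   given by membership predicate memX and norm nrm *)
Definition banach_function_space (Om : set R) (memX : (R -> R) -> Prop)
    (nrm : (R -> R) -> R) : Prop :=
  [/\ (forall f : R -> R, memX f -> measurable_fun Om f),
      (forall f g, memX f -> memX g -> memX (f \+ g)) /\
      (forall (c : R) f, memX f -> memX (fun x => c * f x)),
      (forall f g, memX f -> memX g -> nrm (f \+ g) <= nrm f + nrm g) /\
      (forall (c : R) f, memX f -> nrm (fun x => c * f x) = `|c| * nrm f),
      (forall f, memX f -> nrm f = 0 -> ae_on Om (fun x => f x = 0)) &
      (forall u : nat -> R -> R, (forall n, memX (u n)) ->
         (forall e : R, 0 < e -> exists N : nat, forall m n : nat,
             (N <= m)%N -> (N <= n)%N -> nrm (u m \- u n) < e) ->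
         exists g, memX g /\ (fun n => nrm (u n \- g)) @ \oo --> (0:R))].

Definition ideal_property (Om : set R) (memX : (R -> R) -> Prop)
    (nrm : (R -> R) -> R) : Prop :=
  forall f g : R -> R, memX g -> measurable_fun Om f ->
    ae_on Om (fun x => `|f x| <= `|g x|) -> memX f /\ nrm f <= nrm g.

Definition rearrangement_invariant_space (Om : set R)
    (memX : (R -> R) -> Prop) (nrm : (R -> R) -> R) : Prop :=
  [/\ banach_function_space Om memX nrm,
      ideal_property Om memX nrm,
      (exists w, memX w /\ ae_on Om (fun x => 0 < w x)) &
      (forall f g : R -> R, memX f -> measurable_fun Om g ->
         distrib Om g = distrib Om f -> memX g /\ nrm g = nrm f)].

Definition fatou_property (Om : set R) (memX : (R -> R) -> Prop)
    (nrm : (R -> R) -> R) : Prop :=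
  forall (fn : nat -> R -> R) (f : R -> R),
    (forall n, memX (fn n)) -> measurable_fun Om f ->
    ae_on Om (fun x => (forall n, 0 <= fn n x /\ fn n x <= fn n.+1 x) /\
                       (fun n => fn n x) @ \oo --> f x) ->
    (exists M : R, forall n, nrm (fn n) <= M) ->
    memX f /\ (fun n => nrm (fn n)) @ \oo --> nrm f.

Definition order_continuous (Om : set R) (memX : (R -> R) -> Prop)
    (nrm : (R -> R) -> R) (f : R -> R) : Prop :=
  memX f /\
  forall fn : nat -> R -> R, (forall n, measurable_fun Om (fn n)) ->
    ae_on Om (fun x => (forall n, 0 <= fn n x /\ fn n x <= `|f x|
                                  /\ fn n.+1 x <= fn n x) /\
                       (fun n => fn n x) @ \oo --> (0:R)) ->
    (fun n => nrm (fn n)) @ \oo --> (0:R).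

Definition dist_Xa (Om : set R) (memX : (R -> R) -> Prop)
    (nrm : (R -> R) -> R) (h : R -> R) : R :=
  inf [set nrm (h \- g) | g in order_continuous Om memX nrm].

End RI.

(* Main.v *)
(** If X_a = 0 the distance is the norm. Otherwise the norm of an indicator
    tends to 0 with the measure of the set, so X_a contains every bounded
    element of X whose support B has finite measure and 1_B in X, and one shows
    directly that the distance to X_a is the same for equimeasurable f1, f2.
    From above, dist(f1, X_a) is at most the norm of f1 with a band
    a < |f1| <= b of finite measure removed. From below, if g is in X_a and the
    sets E_n decrease to a null set then ||g 1_{E_n}|| -> 0, so that
    ||f2 1_{E_n}|| is at most ||f2 - g|| + o(1). It remains to choose the bands
    and the E_n so that both remainders have (almost) the same distribution;
    the choice depends on whether all the sets {|f| > l}, l > 0, have finite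
    measure. *)
Require Import Defs.
From HB Require Import structures.
From mathcomp Require Import all_boot all_order all_algebra.
From mathcomp Require Import all_classical all_reals all_analysis.
From mathcomp Require Import measurable_realfun lra.
Set Implicit Arguments.
Unset Strict Implicit.
Unset Printing Implicit Defensive.
Import Order.TTheory GRing.Theory Num.Theory.
Import numFieldNormedType.Exports.
Local Open Scope classical_set_scope.
Local Open Scope ring_scope.

(** * Measurability and null sets for Lebesgue measure *)

Section LebesgueSets.
Variable R : realType.
Local Notation mu := (@lebesgue_measure R).
Implicit Types (Om A B : set R) (f g : R -> R).

Lemma measurable_fun_ite Om A f g : measurable Om -> measurable A ->
  measurable_fun Om f -> measurable_fun Om g ->
  measurable_fun Om (fun x => if x \in A then f x else g x).
Proof.
move=> mOm mA mf mg; apply: measurable_fun_if => //.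
- apply: (@measurable_fun_bool _ _ _ _ true).
  have -> : Om `&` (fun x => x \in A) @^-1` [set true] = Om `&` A.
    by apply/seteqP; split=> x /= [Ox Ax]; split=> //; [exact: set_mem|exact: mem_set].
  exact: measurableI.
- by apply: measurable_funS mf => // x [].
- by apply: measurable_funS mg => // x [].
Qed.

Lemma measurable_superlevel Om f (l : R) : measurable Om ->
  measurable_fun Om f -> measurable (Om `&` [set x | l < `|f x|]).
Proof.
move=> mOm mf.
have mn : measurable_fun Om (fun x => `|f x|).
  exact: (measurableT_comp (@normr_measurable R setT) mf).
have -> : [set x | l < `|f x|] = (fun x => `|f x|) @^-1` `]l, +oo[.
  by apply/seteqP; split=> x /=; rewrite in_itv /= andbT.
exact: mn.
Qed.

Lemma lebesgue_nonincreasing_null (F : nat -> set R) (e : \bar R) :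
  (forall n, measurable (F n)) -> (forall n, F n.+1 `<=` F n) ->
  (mu (F 0%N) < +oo)%E -> mu (\bigcap_n F n) = 0%E -> (0 < e)%E ->
  \forall n \near \oo, (mu (F n) < e)%E.
Proof.
move=> mF dF F0 I0 e0.
have dF' : {homo F : n m / (n <= m)%N >-> (m <= n)%O}.
  by apply/nonincreasing_seqP => n; apply/subsetPset; exact: dF.
have H : (mu \o F) n @[n --> \oo] --> 0%E.
  by rewrite -I0; apply: nonincreasing_cvg_mu => //; exact: bigcapT_measurable.
apply: (H [set y | (y < e)%E]).
exact: open_ereal_lt'.
Qed.

Lemma le_lebesgue A B : measurable A -> measurable B -> A `<=` B ->
  (mu A <= mu B)%E.
Proof. by move=> mA mB AB; apply: le_measure; rewrite ?inE. Qed.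

Lemma ae_onS Om (P Q : R -> Prop) : (forall x, Om x -> P x -> Q x) ->
  ae_on Om P -> ae_on Om Q.
Proof.
move=> PQ; apply: negligibleS => x /= nQ OP; apply: nQ => Ox.
exact: (PQ _ Ox (OP Ox)).
Qed.

End LebesgueSets.

(** * Basic properties of rearrangement invariant spaces *)

Section RearrangementInvariant.
Variables (R : realType) (Om : set R) (memX : (R -> R) -> Prop)
  (nrm : (R -> R) -> R).
Hypotheses (mOm : measurable Om)
  (Xri : rearrangement_invariant_space Om memX nrm).
Local Notation mu := (@lebesgue_measure R).
Local Notation oc := (order_continuous Om memX nrm).
Implicit Types (f g h : R -> R) (A B : set R).

Lemma ri_measurable f : memX f -> measurable_fun Om f.
Proof. by case: Xri => -[H _ _ _ _] _ _ _; exact: H. Qed.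

Lemma ri_le f g : memX g -> measurable_fun Om f ->
  (forall x, Om x -> `|f x| <= `|g x|) -> memX f /\ nrm f <= nrm g.
Proof.
case: Xri => _ H _ _ Xg mf fg; apply: H => //; exact: aeW.
Qed.

Lemma ri_leM f g : memX g -> measurable_fun Om f ->
  (forall x, Om x -> `|f x| <= `|g x|) -> memX f.
Proof. by move=> Xg mf /(ri_le Xg mf) []. Qed.

Lemma ri_norm_le f g : memX g -> measurable_fun Om f ->
  (forall x, Om x -> `|f x| <= `|g x|) -> nrm f <= nrm g.
Proof. by move=> Xg mf /(ri_le Xg mf) []. Qed.

(** Equality almost everywhere gives domination in both directions, so the ideal property applies
    twice. *)
Lemma ri_ae f g : memX g -> measurable_fun Om f ->
  ae_on Om (fun x => f x = g x) -> nrm f = nrm g.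
Proof.
case: Xri => _ H _ _ Xg mf fg.
have [Xf le1] : memX f /\ nrm f <= nrm g.
  by apply: H => //; apply: ae_onS fg => x Ox ->.
have [_ le2] : memX g /\ nrm g <= nrm f.
  apply: H => //; first exact: ri_measurable.
  by apply: ae_onS fg => x Ox ->.
by apply/eqP; rewrite eq_le le1.
Qed.

Lemma riD f g : memX f -> memX g -> memX (f \+ g).
Proof. by case: Xri => -[_ [H _] _ _ _] _ _ _; exact: H. Qed.

Lemma riZ (c : R) f : memX f -> memX (fun x => c * f x).
Proof. by case: Xri => -[_ [_ H] _ _ _] _ _ _; exact: H. Qed.

Lemma ri_normD f g : memX f -> memX g -> nrm (f \+ g) <= nrm f + nrm g.
Proof. by case: Xri => -[_ _ [H _] _ _] _ _ _; exact: H. Qed.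

Lemma ri_normZ (c : R) f : memX f -> nrm (fun x => c * f x) = `|c| * nrm f.
Proof. by case: Xri => -[_ _ [_ H] _ _] _ _ _; exact: H. Qed.

Lemma riB f g : memX f -> memX g -> memX (f \- g).
Proof.
move=> Xf Xg; have -> : f \- g = f \+ (fun x => -1 * g x).
  by apply/funext => x /=; rewrite mulN1r.
by apply: riD => //; exact: riZ.
Qed.

Lemma ri_equi f g : memX f -> measurable_fun Om g ->
  distrib Om g = distrib Om f -> memX g /\ nrm g = nrm f.
Proof. by case: Xri => _ _ _ H; exact: H. Qed.

Lemma ri_0 : memX (fun=> 0) /\ nrm (fun=> 0) = 0.
Proof.
case: Xri => _ _ [w [Xw _]] _.
have -> : (fun=> 0) = (fun x => 0 * w x) by apply/funext => x; rewrite mul0r.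
by split; [exact: riZ|rewrite ri_normZ// normr0 mul0r].
Qed.

Lemma ri_ge0 f : memX f -> 0 <= nrm f.
Proof.
move=> Xf; rewrite -ri_0.2; apply: ri_norm_le => // x _.
by rewrite normr0.
Qed.

(** Keeps the set of competitors in [dist_Xa] nonempty and supplies the competitor when X_a is
    trivial. *)
Lemma order_continuous0 : oc (fun=> 0).
Proof.
split; first exact: ri_0.1.
move=> fn mfn fn0.
have fnE n : nrm (fn n) = 0.
  rewrite -[RHS]ri_0.2; apply: ri_ae => //; first exact: ri_0.1.
  apply: ae_onS fn0 => x Ox [/(_ n)[f0 [f1 _]] _].
  by apply/eqP; rewrite eq_le f0 andbT; move: f1; rewrite normr0.
rewrite (_ : (fun n => nrm (fn n)) = (fun=> 0)); last exact/funext.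
exact: cvg_cst.
Qed.

Lemma dist_Xa_le f g : memX f -> oc g -> dist_Xa Om memX nrm f <= nrm (f \- g).
Proof.
move=> Xf ocg; apply: (@ge_inf R); last by exists g.
by exists 0 => _ [h [Xh _] <-]; apply: ri_ge0; exact: riB.
Qed.

(** * Restriction to measurable sets *)

Lemma measurable_cut A f : measurable A -> measurable_fun Om f ->
  measurable_fun Om (f \_ A).
Proof. by move=> mA mf; apply: measurable_fun_ite. Qed.

Lemma norm_cut A f x : `|(f \_ A) x| <= `|f x|.
Proof. by rewrite patchE; case: ifP => //; rewrite normr0. Qed.

Lemma ri_cut A f : measurable A -> memX f -> memX (f \_ A).
Proof.
move=> mA Xf; apply: (ri_leM Xf) => [|x _]; last exact: norm_cut.
by apply: measurable_cut => //; exact: ri_measurable.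
Qed.

Lemma ri_norm_cut A f : measurable A -> memX f -> nrm (f \_ A) <= nrm f.
Proof.
move=> mA Xf; apply: (ri_norm_le Xf) => [|x _]; last exact: norm_cut.
by apply: measurable_cut => //; exact: ri_measurable.
Qed.

(** The functions [|g| 1_{E n}] decrease to 0 outside the intersection of the [E n], so order
    continuity of [g] applies to them. *)
Lemma order_continuous_cut g (E : nat -> set R) (e : R) : oc g ->
  (forall n, measurable (E n)) -> (forall n, E n.+1 `<=` E n) ->
  mu (\bigcap_n E n) = 0%E -> 0 < e ->
  \forall n \near \oo, nrm (g \_ (E n)) < e.
Proof.
move=> [Xg ocg] mE dE E0 e0.
have mg : measurable_fun Om g by exact: ri_measurable.
pose h n := (fun x => `|g x|) \_ (E n).
have mh n : measurable_fun Om (h n).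
  apply: measurable_cut => //.
  exact: (measurableT_comp (@normr_measurable R setT) mg).
have Xh n : memX (h n).
  by apply: (ri_leM Xg) => // x _; rewrite /h patchE; case: ifP; rewrite ?normr_id ?normr0.
have hE n : nrm (g \_ (E n)) <= nrm (h n).
  apply: (ri_norm_le (Xh n)); first exact: measurable_cut.
  by move=> x _; rewrite /h !patchE; case: ifP; rewrite ?normr_id ?normr0.
have /cvgr0Pnorm_lt/(_ e e0) : (fun n => nrm (h n)) @ \oo --> (0 : R).
  apply: ocg => //.
  exists (\bigcap_n E n); split => //; first exact: bigcapT_measurable.
  move=> x /= nP n _; apply: contrapT => nEx; apply: nP => Ox; split.
    move=> k; rewrite /h !patchE; split; first by case: ifP => _; rewrite ?normr_ge0.
    split; first by case: ifP => _; rewrite ?normr_ge0.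
    case: ifP => [/set_mem /dE /mem_set -> //|_].
    by case: ifP => _; rewrite ?normr_ge0.
  apply: cvg_near_cst.
  exists n => // m /= nm.
  rewrite /h patchE; case: ifP => // /set_mem Emx; exfalso; apply: nEx.
  have dE' : {homo E : n m / (n <= m)%N >-> (m <= n)%O}.
    by apply/nonincreasing_seqP => k; apply/subsetPset; exact: dE.
  by move/subsetPset: (dE' _ _ nm); apply.
apply: filterS => n; rewrite ger0_norm ?ri_ge0//; exact: le_lt_trans.
Qed.

(* Order continuous functions do not see the sets [E n], hence subtracting one
   from [f] cannot lower the norm of [f] there in the limit. *)
Lemma norm_cut_le_dist f g (E : nat -> set R) (e : R) : memX f -> oc g ->
  (forall n, measurable (E n)) -> (forall n, E n.+1 `<=` E n) ->
  mu (\bigcap_n E n) = 0%E -> 0 < e ->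
  \forall n \near \oo, nrm (f \_ (E n)) <= nrm (f \- g) + e.
Proof.
move=> Xf ocg mE dE E0 e0.
have := order_continuous_cut ocg mE dE E0 e0.
have Xg := ocg.1.
apply: filterS => n gn.
have Xfg : memX (f \- g) by exact: riB.
have -> : f \_ (E n) = ((f \- g) \_ (E n)) \+ (g \_ (E n)).
  by apply/funext => x /=; rewrite !patchE; case: ifP; rewrite ?addr0 // subrK.
apply: (le_trans (ri_normD _ _)); try exact: ri_cut.
by apply: lerD; [exact: ri_norm_cut|exact: ltW].
Qed.

(** * Indicators and bounded order continuous functions *)

Lemma memX_indic_le f A (d : R) : memX f -> measurable A -> 0 < d ->
  (forall x, A x -> d < `|f x|) -> memX \1_A.
Proof.
move=> Xf mA d0 dA; apply: (@ri_leM _ (fun x => d^-1 * f x)); first exact: riZ.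
  exact: measurable_indic.
move=> x _; rewrite indicE; case: (boolP (x \in A)) => [/set_mem/dA df|_].
  rewrite normr1 normrM gtr0_norm ?invr_gt0// mulrC ler_pdivlMr// mul1r.
  exact: ltW.
by rewrite normr0 normr_ge0.
Qed.

(** The right side sees [A] only through [mu A], so sets of equal measure have equimeasurable
    indicators. *)
Lemma distrib_indic A (l : R) : A `<=` Om -> distrib Om \1_A l =
  if l < 0 then mu Om else if l < 1 then mu A else 0%E.
Proof.
move=> AOm; rewrite /distrib /leb; case: ifPn => [l0|].
  congr (mu _); apply/seteqP; split=> x /=; first by case.
  by move=> Ox; split=> //; exact: lt_le_trans (normr_ge0 _).
rewrite -leNgt => l0; case: ifPn => [l1|].
  congr (mu _); apply/seteqP; split=> x /=.
    move=> [_]; rewrite indicE; case: (boolP (x \in A)) => [/set_mem//|_].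
    by rewrite normr0 ltNge l0.
  by move=> Ax; split; [exact: AOm|rewrite indicE mem_set// normr1].
rewrite -leNgt => l1; rewrite (_ : _ `&` _ = set0) ?measure0//.
rewrite -subset0 => x /= [_]; rewrite indicE.
by case: (x \in A); rewrite ?normr1 ?normr0 ltNge ?l0 ?l1.
Qed.

Lemma ri_indic A B : measurable A -> measurable B -> A `<=` Om -> B `<=` Om ->
  mu A = mu B -> memX \1_A -> memX \1_B /\ nrm \1_B = nrm \1_A.
Proof.
move=> mA mB AO BO AB XA; apply: (ri_equi XA); first exact: measurable_indic.
by apply/funext => l; rewrite !distrib_indic// AB.
Qed.

(** The fundamental function of X (the norm of an indicator as a function of the measure of the set)
    tends to 0 at 0, as far as the indicators belong to X. *)
Definition norm_of_small_sets_vanishes := forall e : R, 0 < e ->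
  exists2 eta : R, 0 < eta & forall B, measurable B -> B `<=` Om ->
    (mu B < eta%:E)%E -> memX \1_B -> nrm \1_B <= e.

(** A sequence under [|h|] is at most [d] on [B], except where it exceeds [d], and there it is at
    most [M]. As [B] has finite measure, the exceptional set becomes small in measure, as in
    Egorov's theorem, and [small] controls its indicator. *)
Lemma order_continuous_bounded h B (M : R) : norm_of_small_sets_vanishes ->
  memX h -> measurable B -> B `<=` Om -> (mu B < +oo)%E -> memX \1_B ->
  0 <= M -> (forall x, Om x -> `|h x| <= M * \1_B x) -> oc h.
Proof.
move=> small Xh mB BO Boo XB M0 hM; split => // fn mfn fnP.
apply/cvgr0Pnorm_lt => e e0.
pose K := nrm \1_B.
have K0 : 0 <= K by exact: ri_ge0.
(* Each of the two parts of the bound may cost [e / 2]; the [+ 1] in the denominators avoids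
   division by zero. *)
pose d := e / 2 / (K + 1).
have d0 : 0 < d by rewrite divr_gt0 ?divr_gt0//; lra.
have e'0 : 0 < e / 2 / (M + 1) by rewrite divr_gt0 ?divr_gt0//; lra.
have [eta eta0 etaP] := small _ e'0.
pose G n := B `&` (Om `&` [set x | d < `|fn n x|]).
have mG n : measurable (G n).
  by apply: measurableI => //; exact: measurable_superlevel.
(* The tail unions are nested, whereas the [G k] are nested only up to null sets. At a point lying
   in all of them, [fn n x] does not tend to 0. *)
pose F n := \bigcup_(k in [set k | (n <= k)%N]) G k.
have mF n : measurable (F n) by apply: bigcup_measurable => k _.
have dF n : F n.+1 `<=` F n by move=> x [k /= nk Gx]; exists k => //=; exact: ltnW.
have F0oo : (mu (F 0%N) < +oo)%E.
  apply: le_lt_trans Boo; apply: le_lebesgue => //.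
  by move=> x [k _ []].
have F0 : mu (\bigcap_n F n) = 0%E.
  apply: measure_negligible; first exact: bigcapT_measurable.
  apply: negligibleS fnP => x /= Fx H.
  have Ox : Om x by have [k _ [/BO]] := Fx 0%N I.
  have [_ /cvgr0Pnorm_lt /(_ _ d0) [N _ NP]] := H Ox.
  have [k /= Nk [_ [_ /=]]] := Fx N I.
  by rewrite ltNge => /negP; apply; exact/ltW/NP.
have eta0' : (0 < eta%:E)%E by rewrite lte_fin.
have := lebesgue_nonincreasing_null mF dF F0oo F0 eta0'.
apply: filterS => n Fn.
have GF : (mu (G n) < eta%:E)%E.
  apply: le_lt_trans Fn; apply: le_lebesgue => //.
  by move=> x Gx; exists n => /=.
have XG : memX \1_(G n).
  apply: (ri_leM XB) => [|x _]; first exact: measurable_indic.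
  rewrite !indicE; case: (boolP (x \in G n)) => [/set_mem[/mem_set -> _]//|_].
  by rewrite normr0.
have GO : G n `<=` Om by move=> x [/BO].
have Xg : memX ((fun x => d * \1_B x) \+ (fun x => M * \1_(G n) x)).
  by apply: riD; exact: riZ.
have [Xfn fnle] : memX (fn n) /\ nrm (fn n) <=
    nrm ((fun x => d * \1_B x) \+ (fun x => M * \1_(G n) x)).
  case: Xri => _ H _ _; apply: H => //.
  apply: ae_onS fnP => x Ox [/(_ n) [f0 [fh _]] _] /=.
  have := hM x Ox; rewrite !indicE (ger0_norm f0).
  case: (boolP (x \in B)) => [/set_mem xB|xB] hx; last first.
    apply: (le_trans fh); apply: (le_trans hx); rewrite /= mulr0.
    exact: normr_ge0.
  have [dfn|dfn] := ltP d (fn n x).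
    have -> : x \in G n by apply/mem_set; do !split => //=; rewrite ger0_norm.
    by rewrite /= !mulr1 ger0_norm; move: fh hx; rewrite /= ?mulr1; lra.
  rewrite mulr1; apply: (le_trans dfn); apply: le_trans (ler_norm _).
  by rewrite lerDl mulr_ge0.
rewrite ger0_norm ?ri_ge0//; apply: (le_lt_trans fnle).
apply: (le_lt_trans (ri_normD (riZ _ XB) (riZ _ XG))).
rewrite !ri_normZ// (ger0_norm M0) (gtr0_norm d0).
have H1 : d * K <= e / 2.
  rewrite /d mulrAC ler_pdivrMr; last by lra.
  by apply: ler_wpM2l; lra.
have H2 : M * nrm \1_(G n) < e / 2.
  apply: (@le_lt_trans _ _ (M * (e / 2 / (M + 1)))).
    by apply: ler_wpM2l => //; exact: etaP.
  rewrite mulrA ltr_pdivrMr; last by lra.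
  by rewrite mulrC ltr_pM2l; lra.
rewrite -/K; lra.
Qed.

(** * Sets of small measure *)

Hypothesis HOm : Om = [set x : R | 0 < x < 1] \/ Om = [set x : R | 0 < x].

Lemma domain_gt0 x : Om x -> 0 < x.
Proof. by case: HOm => -> //= /andP[]. Qed.

(** Both choices of [Om] start at 0. These segments serve as model sets of prescribed measure, [+oo]
    included for the half-line. *)
Lemma measure_initial_segment (d : \bar R) : (0 <= d <= mu Om)%E ->
  mu (Om `&` [set x | (x%:E < d)%E]) = d.
Proof.
have itvE (r : R) : 0 <= r -> mu `]0, r[%classic = r%:E.
  by move=> r0; rewrite lebesgue_measure_itv/= lte_fin; case: ltgtP r0 => // [_|<-];
    rewrite ?oppr0 ?adde0.
case/andP=> d0 dO.
case: HOm => E; last first.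
  rewrite E; case: d d0 dO => [r| |] //.
    rewrite lee_fin => r0 _; rewrite -[RHS]itvE//; congr (mu _).
    by apply/seteqP; split=> x /=; rewrite in_itv/= lte_fin; [by case=> -> ->|by case/andP].
  move=> _ _; rewrite (_ : _ `&` _ = `]0, +oo[%classic).
    by rewrite lebesgue_measure_itv/= ltry oppr0 adde0.
  apply/seteqP; split=> x /=; rewrite in_itv/= andbT; first by case.
  by move=> ?; split => //; rewrite ltry.
have O1 : mu Om = 1%E.
  rewrite -(itvE 1)//; congr (mu _); rewrite E.
  by apply/seteqP; split=> x /=; rewrite in_itv.
move: dO; rewrite O1; case: d d0 => [r| |] //.
rewrite !lee_fin => r0 r1; rewrite -[RHS]itvE//; congr (mu _); rewrite E.
apply/seteqP; split=> x /=; rewrite in_itv/= lte_fin.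
  by case=> /andP[-> _] ->.
case/andP=> x0 xr.
by split => //; rewrite x0 (lt_le_trans xr).
Qed.

(** A nonzero [g] exceeds some [d] on a set of positive measure. Pieces [E n] of it, of positive
    measure but shrinking to a null set, have indicators of norm at most [nrm (g \_ (E n)) / d],
    which tends to 0. Rearrangement invariance carries this to every set of smaller measure. *)
Lemma small_sets_of_order_continuous g : oc g -> ~ ae_on Om (fun x => g x = 0) ->
  norm_of_small_sets_vanishes.
Proof.
move=> ocg gn0; have Xg := ocg.1; have mg := ri_measurable Xg.
have [d d0 dP] : exists2 d : R, 0 < d & mu (Om `&` [set x | d < `|g x|]) != 0%E.
  apply: contrapT => H; apply: gn0.
  have : mu.-negligible (\bigcup_n (Om `&` [set x | n.+1%:R^-1 < `|g x|])).
    apply: negligible_bigcup => n; exists (Om `&` [set x | n.+1%:R^-1 < `|g x|]).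
    split => //; first exact: measurable_superlevel.
    apply: contrapT => /eqP N; apply: H; exists n.+1%:R^-1 => //.
  apply: negligibleS => x /= N.
  apply: contrapT => nU; apply: N => Ox; apply: contrapT => /eqP g0; apply: nU.
  have : 0 < `|g x| by rewrite normr_gt0.
  by move=> /ltr_add_invr[k]; rewrite add0r => kg; exists k.
pose A := Om `&` [set x | d < `|g x|].
have mA : measurable A by exact: measurable_superlevel.
(* Scanning [A] from the left locates the point [t0] where it starts to carry measure. *)
pose L t := A `&` `]-oo, t[%classic.
have mL t : measurable (L t) by exact: measurableI.
have L_mono s t : s <= t -> L s `<=` L t.
  by move=> st x [Ax /=]; rewrite !in_itv/= => xs; split=> //=; rewrite in_itv/= (lt_le_trans xs).
pose T := [set t | mu (L t) != 0%E].
have Tlb : lbound T 0.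
  move=> t Tt; rewrite leNgt; apply/negP => t0; move/negP: Tt; apply; apply/eqP.
  rewrite (_ : L t = set0) ?measure0// -subset0 => x [[/domain_gt0 x0 _]] /=.
  by rewrite in_itv/= => xt; move: (lt_trans xt t0); rewrite ltNge (ltW x0).
have T0 : T !=set0.
  apply: contrapT => /nonemptyPn TE; move/negP: dP; apply; apply/eqP.
  apply: measure_negligible => //.
  have : mu.-negligible (\bigcup_n L n%:R).
    apply: negligible_bigcup => n; exists (L n%:R); split; [exact: mL| |by []].
    apply: contrapT => /eqP N.
    by have : T n%:R by []; rewrite TE.
  apply: negligibleS => x Ax; exists (Num.truncn x).+1 => //; split => //=.
  by rewrite in_itv/=; exact: truncnS_gt.
pose t0 := inf T.
(* Left of [t0] the set [A] is null, so [A] charges every [E n]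
   although these decrease to a null set. *)
pose E n := L (t0 + n.+1%:R^-1).
have E0 n : mu (E n) != 0%E.
  have [t Tt tlt] : exists2 t, T t & t < t0 + n.+1%:R^-1.
    by apply: inf_adherent => //; split=> //; exists 0.
  apply: contra_neq Tt => En; apply/eqP; rewrite eq_le measure_ge0 andbT -En.
  by apply: le_lebesgue; [exact: mL|exact: mL|exact: L_mono (ltW tlt)].
have Eoo n : (mu (E n) < +oo)%E.
  apply: (@le_lt_trans _ _ (mu `]0, t0 + n.+1%:R^-1[%classic)).
    apply: le_lebesgue; [exact: mL|exact: measurable_itv|].
    by move=> x [[/domain_gt0 x0 _]] /=; rewrite !in_itv/= x0.
  by rewrite lebesgue_measure_itv/=; case: ifP => // _; rewrite -EFinB ltry.
have dE n : E n.+1 `<=` E n.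
  by apply: L_mono; rewrite lerD2l lef_pV2 ?posrE// ler_nat.
have IE : mu (\bigcap_n E n) = 0%E.
  apply: measure_negligible; first by apply: bigcapT_measurable => n; exact: mL.
  (* A point of the intersection lies in [A] to the left of [t0], where [A] is null, or is [t0]
     itself. *)
  have N1 : mu.-negligible (\bigcup_n L (t0 - n.+1%:R^-1)).
    apply: negligible_bigcup => n; exists (L (t0 - n.+1%:R^-1)); split; [exact: mL| |by []].
    apply: contrapT => /eqP N.
    have : t0 <= t0 - n.+1%:R^-1 by apply: ge_inf => //; exists 0.
    by rewrite lerBrDr gerDl leNgt invr_gt0 ltr0n.
  have N2 : mu.-negligible [set t0].
    by exists [set t0]; split => //; exact: lebesgue_measure_set1.
  apply: negligibleS (negligibleU N1 N2) => x Ex.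
  have [xt|xt|->] := ltgtP x t0; last by right.
    left; have [k kP] := ltr_add_invr xt.
    exists k => //; split; first by have [] := Ex 0%N I.
    by rewrite /= in_itv/= ltrBrDr.
  have [k kP] := ltr_add_invr xt.
  have [_] := Ex k I; rewrite /= in_itv/= => /ltW; rewrite leNgt => /negP[].
  by [].
move=> e e0.
have de0 : 0 < d * e by rewrite mulr_gt0.
have [n _ nP] := order_continuous_cut ocg (fun n => mL _) dE IE de0.
have gE := nP n (leqnn n).
have EO : E n `<=` Om by move=> x [[]].
have XE : memX \1_(E n).
  by apply: (memX_indic_le Xg (mL _) d0) => x [[]].
have nE : nrm \1_(E n) <= e.
  rewrite -(ler_pM2l d0) -{1}(gtr0_norm d0) -ri_normZ//.
  apply: le_trans (ltW gE); apply: ri_norm_le.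
  - by apply: ri_cut => //; exact: mL.
  - by apply: ri_measurable; exact: riZ.
  - move=> x _; rewrite indicE patchE; case: (boolP (x \in E n)) => [/set_mem[[_ /= dg] _]|_].
      by rewrite mulr1 gtr0_norm// ltW.
    by rewrite mulr0 normr0.
have finE : mu (E n) \is a fin_num by rewrite ge0_fin_numE.
exists (fine (mu (E n))).
  by rewrite fine_gt0// Eoo andbT lt0e E0 measure_ge0.
move=> B mB BO; rewrite fineK// => BE XB.
have measO A' : measurable A' -> A' `<=` Om -> (0 <= mu A' <= mu Om)%E.
  by move=> mA' AO; rewrite measure_ge0/=; exact: le_lebesgue.
(* [B] and [E n] are replaced by initial segments of the same measures, which are nested because
   [mu B < mu (E n)]. *)
have BI := measure_initial_segment (measO _ mB BO).
have EI := measure_initial_segment (measO _ (mL _) EO).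
have mI (s : \bar R) : measurable (Om `&` [set x | (x%:E < s)%E]).
  apply: measurableI => //.
  have := @EFin_measurable R setT measurableT `]-oo, s[%classic.
  rewrite setTI; apply.
  exact: emeasurable_itv.
have [_ <-] := ri_indic mB (mI _) BO (@subIsetl _ _ _) (esym BI) XB.
have [XI EIn] := ri_indic (mL _) (mI _) EO (@subIsetl _ _ _) (esym EI) XE.
apply: le_trans nE; rewrite -EIn; apply: (ri_norm_le XI).
  by apply: measurable_indic; exact: mI.
move=> x Ox; rewrite !indicE; case: (boolP (x \in _ `&` _)) => [/set_mem[_ /= xB]|_].
  by rewrite mem_set//=; split => //=; exact: lt_trans xB BE.
by rewrite normr0 normr_ge0.
Qed.

(** * Distances of equimeasurable functions *)

Local Notation S f l := (Om `&` [set x | l < `|f x|]).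

Lemma measurable_S f (l : R) : memX f -> measurable (S f l).
Proof. by move=> Xf; apply: measurable_superlevel => //; exact: ri_measurable. Qed.

Lemma subset_superlevel f (k l : R) : k <= l -> S f l `<=` S f k.
Proof. by move=> kl x [Ox lx]; split => //; exact: le_lt_trans lx. Qed.

Lemma distrib_lt0 f (l : R) : l < 0 -> distrib Om f l = mu Om.
Proof.
move=> l0; rewrite /distrib /leb; congr (mu _).
by apply/seteqP; split=> [x []//|x Ox]; split=> //=; exact: lt_le_trans (normr_ge0 _).
Qed.

(* Otherwise [2 f] and [f] would be equimeasurable, forcing [nrm f = 0]. *)
Lemma distrib_lty f : memX f -> exists2 l : R, 0 < l & (distrib Om f l < +oo)%E.
Proof.
move=> Xf; apply: contrapT => H.
have foo (l : R) : 0 <= l -> distrib Om f l = +oo%E.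
  move=> l0; have l1 : 0 < l + 1 by lra.
  have : distrib Om f (l + 1) = +oo%E.
    apply/eqP; rewrite -leye_eq leNgt; apply/negP => fl; apply: H.
    by exists (l + 1).
  move=> E; apply/eqP; rewrite -leye_eq -E; apply: le_lebesgue; try exact: measurable_S.
  by apply: subset_superlevel; lra.
have X2f := riZ 2 Xf.
have [_] : memX (fun x => 2 * f x) /\ nrm (fun x => 2 * f x) = nrm f.
  apply: ri_equi => //; first exact: ri_measurable.
  apply/funext => l; have [l0|l0] := ltP l 0; first by rewrite !distrib_lt0.
  rewrite [RHS]foo// -(foo (l / 2)); last by lra.
  rewrite /distrib /leb; congr (mu _); apply/seteqP.
  by split=> x /= [Ox]; rewrite normrM ger0_norm// => h; split=> //=; lra.
rewrite ri_normZ// ger0_norm// => nf.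
have nf0 : nrm f = 0 by lra.
have f0 : ae_on Om (fun x => f x = 0) by case: Xri => -[_ _ _ Hz _] _ _ _; exact: Hz.
have := foo 1 ler01; rewrite /distrib /leb measure_negligible//.
  exact: measurable_S.
apply: negligibleS f0 => x [/= Ox fx] /(_ Ox) E.
by move: fx; rewrite E normr0; lra.
Qed.

(** The measure of a band is a difference of two values of the distribution function; the
    subtraction is legitimate because the upper level set has finite measure. *)
Lemma distribD f1 f2 (k l : R) : memX f1 -> memX f2 ->
  distrib Om f1 = distrib Om f2 -> k <= l -> (distrib Om f1 l < +oo)%E ->
  mu (S f1 k `\` S f1 l) = mu (S f2 k `\` S f2 l).
Proof.
move=> X1 X2 E kl foo.
have D f : memX f -> (mu (S f k `\` S f l) + distrib Om f l)%E = distrib Om f k.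
  move=> Xf; rewrite /distrib /leb -measureU;
    [|by apply: measurableD; exact: measurable_S|exact: measurable_S|].
    by congr (mu _); rewrite setUC setDUK//; exact: subset_superlevel.
  by apply/seteqP; split=> // x [[_ nS] Sx].
have := D _ X1; rewrite {2}E -(D _ X2) -E.
have fin1 : distrib Om f1 l \is a fin_num by rewrite ge0_fin_numE// measure_ge0.
by move/(congr1 (fun z => (z - distrib Om f1 l)%E)); rewrite !addeK.
Qed.

(** On the band, [|f|] is at most [b], and being above [a] puts the indicator of the band in X. With
    finite measure from [foo], the restriction of [f] to the band lies in X_a and is a
    competitor. *)
Lemma dist_Xa_le_cut f (a b : R) : norm_of_small_sets_vanishes -> memX f ->
  0 < a -> 0 <= b -> (distrib Om f a < +oo)%E ->
  dist_Xa Om memX nrm f <= nrm (f \_ (~` (S f a `\` S f b))).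
Proof.
move=> small Xf a0 b0 foo.
set B := S f a `\` S f b.
have mB : measurable B by apply: measurableD; exact: measurable_S.
have -> : f \_ (~` B) = f \- (f \_ B).
  apply/funext => x /=; rewrite !patchE in_setC.
  by case: (x \in B); rewrite ?subrr ?subr0.
apply: dist_Xa_le => //.
apply: (order_continuous_bounded (B := B) (M := b)) => //.
- exact: ri_cut.
- by move=> x [[]].
- apply: le_lt_trans foo; apply: le_lebesgue => //; last by move=> x [].
  exact: measurable_S.
- by apply: (memX_indic_le Xf mB a0) => x [[]].
- move=> x Ox; rewrite indicE patchE; case: (boolP (x \in B)) => [/set_mem[_ nS]|_].
    by rewrite mulr1 leNgt; apply/negP => bf; apply: nS.
  by rewrite normr0 mulr0.
Qed.

(* Subtracting the band [1/n < |f| <= n] leaves equimeasurable remainders for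
   [f1] and [f2]. *)
Lemma dist_Xa_le_vanishing f1 f2 g (e : R) : norm_of_small_sets_vanishes ->
  memX f1 -> memX f2 -> distrib Om f1 = distrib Om f2 ->
  (forall l : R, 0 < l -> (distrib Om f1 l < +oo)%E) -> oc g -> 0 < e ->
  dist_Xa Om memX nrm f1 <= nrm (f2 \- g) + e.
Proof.
move=> small X1 X2 E12 foo ocg e0.
pose B f n := S f n.+1%:R^-1 `\` S f n.+1%:R.
(* The zeros of [f] are left out: they lie outside every band and could keep the intersection of the
   [E f n] from being null. *)
pose E f n := S f 0 `\` B f n.
have mB f n : memX f -> measurable (B f n) by move=> Xf; apply: measurableD; exact: measurable_S.
have mE f n : memX f -> measurable (E f n).
  by move=> Xf; apply: measurableD; [exact: measurable_S|exact: mB].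
have dE n : E f2 n.+1 `<=` E f2 n.
  move=> x [S0 nB]; split => //; apply: contra_not nB => -[[Ox a] b]; split.
    by split => //; apply: le_lt_trans a; rewrite lef_pV2 ?posrE// ler_nat.
  by apply: contra_not b; apply: subset_superlevel; rewrite ler_nat.
have IE : mu (\bigcap_n E f2 n) = 0%E.
  rewrite (_ : \bigcap_n _ = set0) ?measure0// -subset0 => x Ex.
  have [[Ox /= fx] _] := Ex 0%N I.
  have [k kf] := ltr_add_invr fx; rewrite add0r in kf.
  (* At this index the band contains [x]: its lower end is below [|f2 x|] and its upper end
     above. *)
  pose m := maxn k (Num.truncn `|f2 x|).
  have [_] := Ex m I; apply; split.
    split=> //=; apply: le_lt_trans kf.
    by rewrite lef_pV2 ?posrE// ler_nat ltnS leq_maxl.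
  move=> [_ /=]; rewrite ltNge => /negP; apply; apply: ltW.
  by apply: (lt_le_trans (truncnS_gt _)); rewrite ler_nat ltnS leq_maxr.
have [n _ nP] := norm_cut_le_dist X2 ocg (fun n => mE _ n X2) dE IE e0.
apply: le_trans (nP n (leqnn n)) => {nP}.
have n1 : n.+1%:R^-1 <= n.+1%:R :> R.
  by apply: (@le_trans _ _ 1); rewrite ?invf_le1// ler1n.
have ninv : 0 < n.+1%:R^-1 :> R by rewrite invr_gt0.
apply: (le_trans (dist_Xa_le_cut (b := n.+1%:R) small X1 ninv (ler0n _ _) (foo _ ninv))).
rewrite -/(B f1 n).
(* On [Om] the two cuts differ only at zeros of [f1]. *)
apply: (@le_trans _ _ (nrm (f1 \_ (E f1 n)))).
  apply: ri_norm_le.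
  - by apply: ri_cut => //; exact: mE.
  - by apply: measurable_cut; [exact: measurableC (mB _ n X1)|exact: ri_measurable].
  - move=> x Ox; rewrite !patchE.
    have [->|f0] := eqVneq (f1 x) 0; first by rewrite !if_same normr0.
    have -> // : (x \in E f1 n) = (x \in ~` B f1 n).
    apply/idP/idP => /set_mem h; apply/mem_set; first by case: h.
    by split => //; split => //=; rewrite normr_gt0.
suff [_ ->] : memX (f1 \_ (E f1 n)) /\ nrm (f1 \_ (E f1 n)) = nrm (f2 \_ (E f2 n)).
  by [].
apply: (ri_equi (ri_cut (mE _ n X2) X2)).
- by apply: measurable_cut; [exact: mE|exact: ri_measurable].
apply/funext => l; have [l0|l0] := ltP l 0; first by rewrite !distrib_lt0.
have dB f : distrib Om (f \_ (E f n)) l = mu (S f l `\` B f n).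
  rewrite /distrib /leb; congr (mu _); apply/seteqP; split=> x /=.
    move=> [Ox]; rewrite patchE; case: ifPn => [/set_mem[_ nB] lf|_]; first by [].
    by rewrite normr0 ltNge l0.
  move=> [[Ox lf] nB]; split => //; rewrite patchE mem_set//.
  by split => //; split => //=; exact: le_lt_trans lf.
rewrite !dB.
(* What exceeds [l] outside the band splits into a part below the band and a part above it, both
   determined by the distribution function. *)
have SE f : memX f -> mu (S f l `\` B f n) =
   (mu (S f l `\` S f (n.+1%:R^-1)%R) + distrib Om f (Num.max l n.+1%:R)%R)%E.
  move=> Xf; rewrite /distrib /leb -measureU; try exact: measurable_S.
  - congr (mu _); apply/seteqP; split=> x.
      move=> [[Ox lf] nB]; have [|nS] := pselect (S f n.+1%:R x).
        by move=> [_ nf]; right; split=> //=; rewrite gt_max lf.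
      by left; split=> // Sx; apply: nB.
    move=> [[Sl nS]|[Ox /=]]; first by split=> // -[].
    by rewrite gt_max => /andP[lf nf]; split=> // -[_ []].
  - by apply: measurableD; exact: measurable_S.
  - rewrite -subset0 => x [[_ nS] [Ox /=]]; rewrite gt_max => /andP[_ nf]; apply: nS.
    by split=> //=; exact: le_lt_trans nf.
rewrite !SE// E12; congr (_ + _)%E.
have [ln|nl] := leP l n.+1%:R^-1; first by apply: distribD => //; exact: foo.
have D0 f : S f l `\` S f n.+1%:R^-1 = set0.
  by rewrite -subset0 => x [Sl]; apply; move: Sl; apply: subset_superlevel; exact: ltW.
by rewrite !D0.
Qed.

Lemma measure_domain_distrib f (l : R) : memX f -> distrib Om f l = +oo%E -> mu Om = +oo%E.
Proof.
move=> Xf E; apply/eqP; rewrite -leye_eq -E; apply: le_lebesgue => //.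
by apply: measurable_S.
Qed.

(** The superlevel set and [Om] both have infinite measure, so their indicators are
    equimeasurable. *)
Lemma memX_one f (l : R) : memX f -> 0 < l -> distrib Om f l = +oo%E -> memX \1_Om.
Proof.
move=> Xf l0 foo; have mS := measurable_S l Xf.
have XS : memX \1_(S f l) by apply: (memX_indic_le Xf mS l0) => x [].
have mSO : mu (S f l) = mu Om by rewrite (measure_domain_distrib Xf foo).
have sub : S f l `<=` Om by move=> x [].
by have [] := ri_indic mS mOm sub (@subset_refl _ Om) mSO XS.
Qed.

(* With [c] the supremum of the levels of infinite measure, the remainder of
   [f1] is compared with [psi1], equal to [f1] where [|f1| > n] and to [c - d]
   elsewhere. It is equimeasurable with [psi2], which is [c - d] only on the
   part of [|f2| > c - d] lying in [n, oo): these parts still have infinite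
   measure but decrease to the empty set. *)
Lemma dist_Xa_le_not_vanishing f1 f2 g (e l : R) : norm_of_small_sets_vanishes ->
  memX f1 -> memX f2 -> distrib Om f1 = distrib Om f2 ->
  0 < l -> distrib Om f1 l = +oo%E -> oc g -> 0 < e ->
  dist_Xa Om memX nrm f1 <= nrm (f2 \- g) + e.
Proof.
move=> small X1 X2 E12 l0 loo ocg e0.
have X1O := memX_one X1 l0 loo.
have Ooo := measure_domain_distrib X1 loo.
pose T := [set t : R | 0 < t /\ distrib Om f1 t = +oo%E].
have Tl : T l by [].
have [u u0 uoo] := distrib_lty X1.
have Tu : ubound T u.
  move=> t [_ too]; rewrite leNgt; apply/negP => ut.
  move: uoo; rewrite ltNge => /negP; apply; rewrite -too.
  apply: le_lebesgue; try exact: measurable_S.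
  by apply: subset_superlevel; exact: ltW.
have hsT : has_sup T by split; [exists l|exists u].
pose c := sup T.
have lc : l <= c by apply: ub_le_sup => //; exists u.
have c0 : 0 < c by lra.
pose K := nrm \1_Om.
have K0 : 0 <= K by exact: ri_ge0.
(* [d <= c / 2] keeps [c - d] positive; the other bound makes a uniform error of [2 * d] cost at
   most [e / 2] in norm. *)
pose d := Num.min (c / 2) (e / 4 / (K + 1)).
have d0 : 0 < d by rewrite lt_min !divr_gt0//; lra.
have dc : d < c by rewrite gt_min; apply/orP; left; lra.
have dK : 2 * d * K <= e / 2.
  have : d <= e / 4 / (K + 1) by rewrite ge_min lexx orbT.
  rewrite ler_pdivlMr; [nra|lra].
have cdoo : (distrib Om f1 (c + d) < +oo)%E.
  rewrite ltey; apply/eqP => E.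
  have : c + d <= c by apply: ub_le_sup; [exists u|split=> //; lra].
  by lra.
have cd'oo : distrib Om f2 (c - d) = +oo%E.
  have [t [t0 too] ct] := sup_adherent d0 hsT.
  apply/eqP; rewrite -leye_eq -too E12.
  apply: le_lebesgue; try exact: measurable_S.
  by apply: subset_superlevel; exact: ltW.
pose E n := S f2 n%:R `|` (S f2 (c - d) `&` `[n%:R, +oo[%classic).
have mE n : measurable (E n).
  apply: measurableU; first exact: measurable_S.
  by apply: measurableI; [exact: measurable_S|exact: measurable_itv].
have dE n : E n.+1 `<=` E n.
  have nn : n%:R <= n.+1%:R :> R by rewrite ler_nat.
  move=> x [Sx|[Sx /=]]; first by left; exact: subset_superlevel nn _ Sx.
  by rewrite in_itv/= andbT => nx; right; split=> //=; rewrite in_itv/= andbT (le_trans nn).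
have IE : mu (\bigcap_n E n) = 0%E.
  rewrite (_ : \bigcap_n _ = set0) ?measure0// -subset0 => x Ex.
  pose m := maxn (Num.truncn x).+1 (Num.truncn `|f2 x|).+1.
  have [[_ /=]|[_ /=]] := Ex m I.
    apply/negP; rewrite -leNgt; apply: ltW; apply: (lt_le_trans (truncnS_gt _)).
    by rewrite ler_nat leq_maxr.
  rewrite in_itv/= andbT; apply/negP; rewrite -ltNge; apply: (lt_le_trans (truncnS_gt _)).
  by rewrite ler_nat leq_maxl.
have e20 : 0 < e / 2 by lra.
have [n0 _ nP] := norm_cut_le_dist X2 ocg mE dE IE e20.
(* Also [n > c], so that every value above [n] exceeds the filler value [c - d]. *)
pose n := maxn n0 (Num.truncn c).+1.
have cn : c < n%:R.
  by apply: (lt_le_trans (truncnS_gt _)); rewrite ler_nat leq_maxr.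
have fE : nrm (f2 \_ (E n)) <= nrm (f2 \- g) + e / 2 by apply: nP; rewrite /= leq_maxl.
pose psi1 x := if x \in S f1 n%:R then f1 x else c - d.
pose psi2 x := if x \in S f2 n%:R then f2 x else ((fun=> c - d) \_ (E n)) x.
have mS1 : measurable (S f1 n%:R) by exact: measurable_S.
have mS2 : measurable (S f2 n%:R) by exact: measurable_S.
have mp1 : measurable_fun Om psi1.
  by apply: measurable_fun_ite => //; exact: ri_measurable.
have mp2 : measurable_fun Om psi2.
  apply: measurable_fun_ite => //; first exact: ri_measurable.
  exact: measurable_cut.
have XE : memX (f2 \_ (E n)) by exact: ri_cut.
have le2 x : Om x -> `|psi2 x| <= `|(f2 \_ (E n)) x|.
  move=> Ox; rewrite /psi2 !patchE.
  case: (boolP (x \in S f2 n%:R)) => [/set_mem Sx|/negP nS].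
    by rewrite mem_set//; left.
  case: (boolP (x \in E n)) => // /set_mem[Sx|[[_ /= cf] _]].
    by exfalso; apply: nS; exact: mem_set.
  by apply: ltW; rewrite gtr0_norm// subr_gt0.
have Xp2 : memX psi2 := ri_leM XE mp2 le2.
have Ep : distrib Om psi1 = distrib Om psi2.
  apply/funext => k; have [k0|k0] := ltP k 0; first by rewrite !distrib_lt0.
  rewrite /distrib /leb; have [kc|ck] := ltP k (c - d).
    (* Below the filler value both superlevel sets have infinite measure: for [psi2], only points of
       [[0, n]] can be lost from the set where [|f2| > c - d]. *)
    have -> : S psi1 k = Om.
      apply/seteqP; split=> [x []//|x Ox]; split=> //=; rewrite /psi1.
      case: ifPn => [/set_mem[_ /= nf]|_]; last by rewrite gtr0_norm// subr_gt0.
      by apply: lt_trans nf; lra.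
    rewrite Ooo; apply/esym/eqP; rewrite -leye_eq -cd'oo.
    have mpsi : measurable (S psi2 k) by exact: measurable_S.
    have : (distrib Om f2 (c - d) <= mu (S psi2 k `|` `[0%R, n%:R]%classic))%E.
      apply: le_lebesgue; first exact: measurable_S.
        by apply: measurableU => //; exact: measurable_itv.
      move=> x [Ox /= cf]; have [xn|nx] := leP x n%:R.
        by right; rewrite /= in_itv/= xn (ltW (domain_gt0 Ox)).
      left; split=> //=; rewrite /psi2; case: ifPn => [/set_mem[_ /= nf]|_].
        by apply: lt_trans nf; lra.
      rewrite patchE mem_set; first by rewrite gtr0_norm// subr_gt0.
      by right; split=> //=; rewrite in_itv/= andbT ltW.
    rewrite cd'oo => oole.
    have : (+oo <= mu (S psi2 k) + mu `[0%R, n%:R]%classic)%E.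
      by apply: (le_trans oole); apply: measureU2 => //; exact: measurable_itv.
    rewrite lebesgue_measure_itv/= lte_fin (lt_trans c0 cn) oppr0 adde0.
    by case: (mu _).
  (* From the filler value on, only values above [n] count, and these follow the common
     distribution. *)
  have P1 : S psi1 k = S f1 (Num.max n%:R k).
    apply/seteqP; split=> x /= [Ox]; rewrite /psi1 gt_max.
      case: ifPn => [/set_mem[_ /= -> ->]//|_].
      by move=> h; exfalso; move: h; rewrite gtr0_norm ?subr_gt0// ltNge ck.
    by move=> /andP[nf kf]; rewrite mem_set.
  have P2 : S psi2 k = S f2 (Num.max n%:R k).
    apply/seteqP; split=> x /= [Ox]; rewrite /psi2 gt_max.
      case: ifPn => [/set_mem[_ /= -> ->]//|_].
      rewrite patchE; case: ifP => _; last by move=> h; exfalso; move: h; rewrite normr0 ltNge k0.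
      by move=> h; exfalso; move: h; rewrite gtr0_norm ?subr_gt0// ltNge ck.
    by move=> /andP[nf kf]; rewrite mem_set.
  by rewrite P1 P2; exact: (congr1 (fun D => D (Num.max n%:R k)) E12).
have [Xp1 np1] := ri_equi Xp2 mp1 Ep.
have cd0 : 0 < c + d by lra.
apply: (le_trans (dist_Xa_le_cut small X1 cd0 (ler0n _ n) cdoo)).
have Xd : memX (fun x => 2 * d * \1_Om x) by exact: riZ.
(* Outside the band either [psi1] equals [f1], or [|f1| <= c + d = (c - d) + 2 * d]. *)
apply: (@le_trans _ _ (nrm ((fun x => `|psi1 x|) \+ (fun x => 2 * d * \1_Om x)))).
  have Xn : memX (fun x => `|psi1 x|).
    apply: (ri_leM Xp1) => [|x _]; last by rewrite normr_id.
    exact: (measurableT_comp (@normr_measurable R setT) mp1).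
  apply: ri_norm_le; first exact: riD.
    apply: measurable_cut; last exact: ri_measurable.
    by apply: measurableC; apply: measurableD; exact: measurable_S.
  move=> x Ox; rewrite /= indicE mem_set// mulr1.
  rewrite [leRHS]ger0_norm; last by rewrite addr_ge0// mulr_ge0// ltW.
  rewrite patchE /psi1; case: ifPn => [/set_mem nB|_]; last first.
    by rewrite normr0 addr_ge0// mulr_ge0// ltW.
  case: ifPn => [_|/negP nS]; first by rewrite lerDl mulr_ge0// ltW.
  have : `|f1 x| <= c + d.
    rewrite leNgt; apply/negP => cf; apply: nB; split=> // Sx.
    by apply: nS; exact: mem_set.
  by rewrite (gtr0_norm (_ : 0 < c - d)) ?subr_gt0//; lra.
have Xn : memX (fun x => `|psi1 x|) /\ nrm (fun x => `|psi1 x|) <= nrm psi1.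
  apply: ri_le => // [|x _]; last by rewrite normr_id.
  exact: (measurableT_comp (@normr_measurable R setT) mp1).
apply: (le_trans (ri_normD Xn.1 Xd)).
rewrite ri_normZ// ger0_norm; last by rewrite mulr_ge0// ltW.
have := ri_norm_le XE mp2 le2; rewrite -np1 -/K => H.
by move: Xn.2; lra.
Qed.

Lemma dist_Xa_equi_le f1 f2 : memX f1 -> memX f2 ->
  distrib Om f1 = distrib Om f2 ->
  dist_Xa Om memX nrm f1 <= dist_Xa Om memX nrm f2.
Proof.
move=> X1 X2 E12; apply: lb_le_inf.
  by exists (nrm (f2 \- (fun=> 0))); exists (fun=> 0) => //; exact: order_continuous0.
move=> _ [g ocg <-].
have Xg := ocg.1.
have [g0|gn0] := pselect (exists2 g', oc g' & ~ ae_on Om (fun x => g' x = 0)).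
  have [g' og' gn0] := g0.
  have small := small_sets_of_order_continuous og' gn0.
  apply/ler_addgt0Pr => e e0.
  have [foo|] := pselect (forall l : R, 0 < l -> (distrib Om f1 l < +oo)%E).
    exact: dist_Xa_le_vanishing.
  move=> /existsNP[l /not_implyP[l0 /negP]].
  by rewrite -leNgt leye_eq => /eqP loo; exact: dist_Xa_le_not_vanishing l0 loo ocg e0.
(* Here X_a is trivial, so [f2 \- g] has the norm of [f2], which is also that of [f1]. *)
have gz : ae_on Om (fun x => g x = 0).
  by apply: contrapT => gn; apply: gn0; exists g.
apply: (le_trans (dist_Xa_le X1 order_continuous0)).
rewrite (_ : f1 \- _ = f1); last by apply/funext => x /=; rewrite subr0.
have [_ ->] := ri_equi X2 (ri_measurable X1) E12.
rewrite (@ri_ae f2 (f2 \- g))//; [exact: riB|exact: ri_measurable|].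
by apply: ae_onS gz => x _ /= ->; rewrite subr0.
Qed.

(** * The non-increasing rearrangement *)

(** The generalized inverse relation between the rearrangement and the distribution function; the
    strict form rests on right continuity of the latter. *)
Lemma decr_rearr_gt f (t l : R) : memX f -> 0 < t -> 0 <= l ->
  (l < decr_rearr Om f t) = (t%:E < distrib Om f l)%E.
Proof.
move=> Xf t0 l0.
pose I := [set (l%:E)%E | l in [set l : R | 0 < l /\ (distrib Om f l <= t%:E)%E]].
have mono (k m : R) : k <= m -> (distrib Om f m <= distrib Om f k)%E.
  by move=> km; apply: le_lebesgue; try exact: measurable_S; exact: subset_superlevel.
have [b b0 boo] := distrib_lty Xf.
(* An admissible level makes the infimum finite, so that [fine] does not fall back to its default
   value. It exists because superlevel sets of finite measure decrease to the empty set. *)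
have [m m0 mt] : exists2 m : R, 0 < m & (distrib Om f m <= t%:E)%E.
  pose F n := S f (b + n%:R).
  have t0' : (0 < t%:E)%E by rewrite lte_fin.
  have [||| |n _ nP] := @lebesgue_nonincreasing_null _ F (t%:E)%E _ _ _ _ t0'.
  - by move=> n; exact: measurable_S.
  - by move=> n; apply: subset_superlevel; rewrite lerD2l ler_nat.
  - by rewrite /F addr0.
  - rewrite (_ : \bigcap_n _ = set0) ?measure0// -subset0 => x Fx.
    have [_ /=] := Fx (Num.truncn `|f x|).+1 Logic.I.
    by apply/negP; rewrite -leNgt; have := truncnS_gt `|f x|; lra.
  exists (b + n%:R); first by rewrite ltr_wpDr.
  by apply: ltW; apply: nP => /=.
have Im : I m%:E by exists m.
have I0' : lbound I 0%E by move=> _ [k [k0 _] <-]; rewrite lee_fin ltW.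
have Ifin : ereal_inf I \is a fin_num.
  rewrite ge0_fin_numE; last exact: le_ereal_inf_tmp.
  by apply: (@le_lt_trans _ _ m%:E); [exact: ereal_inf_lbound|rewrite ltry].
rewrite /decr_rearr -/I -lte_fin fineK//.
apply/idP/idP.
  apply: contraTT; rewrite -!leNgt => lt.
  (* [l] itself may be 0 while admissible levels are positive, hence the passage through [l + e]. *)
  apply/lee_addgt0Pr => e e0; rewrite -EFinD; apply: ereal_inf_lbound.
  exists (l + e) => //; split; first lra.
  by apply: le_trans lt; apply: mono; lra.
move=> tl.
(* By continuity from below, some level strictly above [l] still has a superlevel set of measure
   more than [t]; no admissible level lies below it. *)
pose G n := S f (l + n.+1%:R^-1).
have mG n : measurable (G n) by exact: measurable_S.
have dG : {homo G : n m / (n <= m)%N >-> (n <= m)%O}.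
  apply/nondecreasing_seqP => n; apply/subsetPset; apply: subset_superlevel.
  by rewrite lerD2l lef_pV2 ?posrE// ler_nat.
have UG : \bigcup_n G n = S f l.
  apply/seteqP; split=> x.
    move=> [n _]; apply: subset_superlevel; by rewrite lerDl.
  move=> [Ox /= lf]; have [n nf] := ltr_add_invr lf; by exists n.
have cvgG : (mu \o G) n @[n --> \oo] --> distrib Om f l.
  rewrite /distrib /leb -UG; apply: nondecreasing_cvg_mu => //.
  exact: bigcupT_measurable.
have [n _ nP] : \forall n \near \oo, (t%:E < mu (G n))%E.
  by apply: (cvgG [set y | (t%:E < y)%E]); exact: open_ereal_gt'.
have {}nP : (t%:E < distrib Om f (l + n.+1%:R^-1))%E by exact: (nP n (leqnn n)).
apply: (@lt_le_trans _ _ (l + n.+1%:R^-1)%:E).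
  by rewrite lte_fin ltrDl.
apply: le_ereal_inf_tmp => _ [k [k0 kt] <-]; rewrite lee_fin leNgt; apply/negP => kn.
have := lt_le_trans nP (mono _ _ (ltW kn)).
by rewrite ltNge kt.
Qed.

Lemma decr_rearr_ge0 f (t : R) : 0 <= decr_rearr Om f t.
Proof.
apply: fine_ge0; apply: le_ereal_inf_tmp => _ [k [k0 _] <-].
by rewrite lee_fin ltW.
Qed.

Lemma decr_rearr_superlevel f (l : R) : memX f -> 0 <= l ->
  Om `&` [set t | l < decr_rearr Om f t] =
  Om `&` [set t | (t%:E < distrib Om f l)%E].
Proof.
move=> Xf l0; apply/seteqP.
by split=> t /= [Ot]; rewrite decr_rearr_gt//; exact: domain_gt0.
Qed.

Lemma measurable_decr_rearr f : memX f -> measurable_fun Om (decr_rearr Om f).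
Proof.
move=> Xf; apply: (measurability _ (RGenOInfty.measurableE R)) => //.
move=> _ [_ [l ->] <-].
have -> : decr_rearr Om f @^-1` `]l, +oo[ = [set t | l < decr_rearr Om f t].
  by apply/seteqP; split=> t /=; rewrite in_itv/= andbT.
have [l0|l0] := ltP l 0.
  rewrite (_ : _ `&` _ = Om)//; apply/seteqP; split=> [t []//|t Ot]; split=> //=.
  exact: lt_le_trans (decr_rearr_ge0 _ _).
rewrite decr_rearr_superlevel//; apply: measurableI => //.
have := @EFin_measurable R setT measurableT `]-oo, distrib Om f l[%classic.
by rewrite setTI; apply; exact: emeasurable_itv.
Qed.

(** At a level [l >= 0] the superlevel set of the rearrangement is the initial segment of length
    [distrib Om f l]. *)
Lemma distrib_decr_rearr f : memX f -> distrib Om (decr_rearr Om f) = distrib Om f.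
Proof.
move=> Xf; apply/funext => l; have [l0|l0] := ltP l 0; first by rewrite !distrib_lt0.
rewrite [LHS]/distrib /leb.
under eq_set do rewrite ger0_norm ?decr_rearr_ge0//.
rewrite decr_rearr_superlevel// measure_initial_segment// measure_ge0/=.
by apply: le_lebesgue => //; exact: measurable_S.
Qed.

End RearrangementInvariant.

Theorem theorem3p5 (R : realType) (Om : set R)
  (HOm : Om = [set x : R | 0 < x < 1] \/ Om = [set x : R | 0 < x])
  (memX : (R -> R) -> Prop) (nrm : (R -> R) -> R) :
  rearrangement_invariant_space Om memX nrm ->
  fatou_property Om memX nrm ->
  forall f : R -> R, memX f ->
    dist_Xa Om memX nrm (decr_rearr Om f) = dist_Xa Om memX nrm f.
Proof.
move=> Xri _ f Xf.
have mOm : measurable Om.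
  case: HOm => ->; last first.
    have -> : [set x : R | 0 < x] = `]0, +oo[%classic.
      by apply/seteqP; split=> x /=; rewrite in_itv/= andbT.
    exact: measurable_itv.
  have -> : [set x : R | 0 < x < 1] = `]0, 1[%classic.
    by apply/seteqP; split=> x /=; rewrite in_itv.
  exact: measurable_itv.
have mfs := measurable_decr_rearr mOm Xri HOm Xf.
have Efs := distrib_decr_rearr mOm Xri HOm Xf.
(* Equimeasurability puts the rearrangement in X and allows the comparison in both directions. *)
have [Xfs _] := ri_equi Xri Xf mfs Efs.
by apply/eqP; rewrite eq_le !(dist_Xa_equi_le mOm Xri HOm).
Qed.
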